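(* Let $X$ be a topological space, $(Y,\mathcal{U})$ a quasi-uniform space, $F:X\to 2^Y$ a multifunction, $x_0\in X$, and let $\mathcal{B}$ be the family of all singletons of $Y$. Then $F$ is V-lsc at $x_0$ if and only if $F$ is $\mathcal{B}$-lsc at $x_0$.
   Context: $2^Y$ is the family of all subsets of $Y$ (including $\emptyset$); a multifunction from $X$ to $Y$ is a map $F:X\to 2^Y$. A quasi-uniformity on $Y$ is a family $\mathcal{U}$ of subsets of $Y\times Y$ such that: every $U\in\mathcal{U}$ contains the diagonal; $U,V\in\mathcal{U}$ implies $U\cap V\in\mathcal{U}$; for every $U\in\mathcal{U}$ there is $V\in\mathcal{U}$ with $V\circ V\subset U$, where $V\circ V=\{(x,y):(x,z),(z,y)\in V\text{ for some }z\in Y\}$; and $U\in\mathcal{U}$, $U\subset V\subset Y\times Y$ implies $V\in\mathcal{U}$. The pair $(Y,\mathcal{U})$ is a quasi-uniform space, and $Y$ carries the topology for which the sets $W(y)=\{z\in Y:(y,z)\in W\}$, $W\in\mathcal{U}$, form a neighbourhood system at $y\in Y$. Put $W^{-1}=\{(z,y):(y,z)\in W\}$ and, for $A\subset Y$, $W^{-1}(A)=\{y\in Y:(z,y)\in W^{-1}\text{ for some }z\in A\}$. $F$ is V-lsc at $x_0$ if for every open $G\subset Y$ with $F(x_0)\cap G\neq\emptyset$ there is a neighbourhood $U(x_0)$ of $x_0$ such that $F(x)\cap G\neq\emptyset$ for every $x\in U(x_0)$. For a family $\mathcal{B}$ of nonempty subsets of $Y$ with $\bigcup\mathcal{B}=Y$,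 $F$ is $\mathcal{B}$-lsc at $x_0$ if for every $W\in\mathcal{U}$ and every $B\in\mathcal{B}$ there is a neighbourhood $U(x_0)$ of $x_0$ such that $F(x_0)\cap B\subset W^{-1}(F(x))$ for every $x\in U(x_0)$. *)

(* Defs.v *)
From HB Require Import structures.
From mathcomp Require Import all_boot all_classical topology.

Set Implicit Arguments.
Unset Strict Implicit.
Unset Printing Implicit Defensive.

Local Open Scope classical_set_scope.
Local Open Scope relation_scope.

Record quasi_uniformity {Y : Type} (U : set_system (Y * Y)) : Prop := {
  quasi_uniformity_diagonal : forall W, U W -> diagonal `<=` W;
  quasi_uniformityI : forall V W, U V -> U W -> U (V `&` W);
  quasi_uniformity_split : forall W, U W -> exists2 V, U V & V \; V `<=` W;
  quasi_uniformityS : forall W V, U W -> W `<=` V -> U V }.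

(* Nonemptiness of the family is not an axiom: when the carrier is inhabited,
   it follows from [nbhs_quasi_entourage], since [nbhs y] contains [setT]. *)
HB.mixin Record Nbhs_isQuasiUniform_mixin M & Nbhs M := {
  quasi_entourage : set_system (M * M);
  quasi_entourageP : quasi_uniformity quasi_entourage;
  nbhs_quasi_entourage : nbhs = nbhs_ quasi_entourage;
}.

#[short(type="quasiUniformType")]
HB.structure Definition QuasiUniform :=
  {T of Topological T & Nbhs_isQuasiUniform_mixin T}.

(* Every nonempty quasi-uniformity on a bare type induces a quasi-uniform space
   with exactly that family of entourages. *)
HB.factory Record isQuasiUniform M & Choice M := {
  quasi_entourage : set_system (M * M);
  quasi_entourageT : quasi_entourage setT;
  quasi_entourageP : quasi_uniformity quasi_entourage;
}.

HB.builders Context M & isQuasiUniform M.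

HB.instance Definition _ := hasNbhs.Build M (nbhs_ quasi_entourage).

Let nbhs_filter (p : M) : ProperFilter (nbhs p).
Proof.
apply: filter_from_proper; last first.
  move=> A UA; exists p; apply/mem_set.
  exact: (quasi_uniformity_diagonal quasi_entourageP UA).
apply: filter_from_filter; first by exists setT; exact: quasi_entourageT.
move=> A B UA UB; exists (A `&` B); last by rewrite xsectionI.
exact: quasi_uniformityI quasi_entourageP _ _ UA UB.
Qed.

Let nbhs_singleton (p : M) A : nbhs p A -> A p.
Proof.
move=> [B UB sBA]; apply/sBA/mem_set.
exact: (quasi_uniformity_diagonal quasi_entourageP UB).
Qed.

Let nbhs_nbhs (p : M) A : nbhs p A -> nbhs p (nbhs^~ A).
Proof.
move=> [B UB sBA].
have [C UC sCB] := quasi_uniformity_split quasi_entourageP UB.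
exists C => // q Cpq; exists C => // r Cqr.
by apply/sBA/mem_set/sCB; exists q; exact/set_mem.
Qed.

HB.instance Definition _ := Nbhs_isNbhsTopological.Build M
  nbhs_filter nbhs_singleton nbhs_nbhs.

HB.instance Definition _ := Nbhs_isQuasiUniform_mixin.Build M
  quasi_entourageP erefl.

HB.end.

Definition rel_image {Y Z : Type} (R : set (Y * Z)) (A : set Y) : set Z :=
  [set y | exists2 z, A z & R (z, y)].

Definition V_lsc {X Y : topologicalType} (F : X -> set Y) (x0 : X) : Prop :=
  forall G : set Y, open G -> F x0 `&` G !=set0 ->
    \forall x \near x0, F x `&` G !=set0.

(* The families [B] for which lower [B]-semicontinuity is considered. *)
Definition nonempty_cover {Y : Type} (B : set_system Y) : Prop :=
  (forall A, B A -> A !=set0) /\ \bigcup_(A in B) A = setT.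

Definition family_lsc {X : topologicalType} {Y : quasiUniformType}
    (B : set_system Y) (F : X -> set Y) (x0 : X) : Prop :=
  forall (W : set (Y * Y)) (A : set Y), quasi_entourage W -> B A ->
    \forall x \near x0, F x0 `&` A `<=` rel_image W^-1 (F x).

Definition singleton_family (Y : Type) : set_system Y := [set [set y] | y in setT].
Arguments singleton_family Y : clear implicits.

Lemma singleton_family_nonempty_cover (Y : Type) : nonempty_cover (singleton_family Y).
Proof.
split=> [_ [y _ <-]|]; first by exists y.
by apply/seteqP; split=> // y _; exists [set y] => //; exists y.
Qed.

(* Main.v *)
Require Import Defs.
From mathcomp Require Import all_boot all_classical topology.

Local Open Scope classical_set_scope.

(** A point [y] lies in [rel_image W^-1 (F x)] exactly when [F x] meets [xsection W y], and these
    sections form a neighbourhood base at [y] ([nbhs_quasi_entourageE]). Both notions thus say that,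
    for each [y] in [F x0] and each neighbourhood of [y], [F x] meets it for all [x] near [x0]. *)

Lemma nbhs_quasi_entourageE (Y : quasiUniformType) (y : Y) (A : set Y) :
  nbhs y A <-> exists2 W, quasi_entourage W & xsection W y `<=` A.
Proof. by rewrite nbhs_quasi_entourage. Qed.

Theorem theorem2p2 (X : topologicalType) (Y : quasiUniformType)
    (F : X -> set Y) (x0 : X) :
  V_lsc F x0 <-> family_lsc (singleton_family Y) F x0.
Proof.
split=> [lscF W _ entW [y _ <-]|lscF G openG [y [Fy Gy]]].
- have [Fy|nFy] := pselect (F x0 y); last first.
    (* [F x0] misses the singleton, so the inclusion is vacuous for every [x]. *)
    by apply: nearW => x z [Fz zy]; case: nFy; rewrite -zy.
  have Wy : nbhs y (xsection W y) by apply/nbhs_quasi_entourageE; exists W.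
  (* V-lsc tests only open sets and [xsection W y] need not be open; its interior still contains
     [y], by [Wy]. *)
  have FW : F x0 `&` interior (xsection W y) !=set0 by exists y.
  apply: filterS (lscF _ (open_interior _) FW) => x [z [Fz Wz]] _ [_ ->].
  by exists z => //; exact: set_mem (interior_subset Wz).
- have /nbhs_quasi_entourageE[W entW WG] : nbhs y G by exact: open_nbhs_nbhs.
  have Sy : singleton_family Y [set y] by exists y.
  apply: filterS (lscF W _ entW Sy) => x /(_ y (conj Fy erefl))[z Fz Wyz].
  by exists z; split=> //; apply/WG/mem_set.
Qed.
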